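(* Consider the Reverse Heterogeneous Firework Process on the vertices $u_i=i$, $i\in\mathbb{N}$, with independent $\mathbb{N}$-valued radii $(R_i)_{i\in\mathbb{N}}$ (not necessarily identically distributed) such that $\mathbb{P}(R_i<1)\in(0,1)$ for all $i$, and let $S$ be the event that the process survives. (I) $\sum_{k=1}^{\infty}\mathbb{P}(R_{n+k}\ge k)=\infty$ for all $n\in\mathbb{N}$ if and only if $\mathbb{P}(S)=1$. (II) If $\sum_{n=1}^{\infty}\prod_{k=1}^{\infty}\mathbb{P}(R_{n+k}<k)<\infty$ then $\mathbb{P}(S)>0$.
   Context: $\mathbb{N}=\{0,1,2,\dots\}$. Reverse Firework Process: let $(R_i)_{i\in\mathbb{N}}$ be independent random variables with values in $\mathbb{N}$ and joint distribution $\mathbb{P}$; it is assumed throughout that $\mathbb{P}(R_i<1)\in(0,1)$ for all $i$. The vertices are the points $i\in\mathbb{N}$. At time $0$ only the origin is activated. At time $1$ all vertices $i\geq 1$ with $i\le R_i$ are activated. In general, at each discrete time $t\ge 1$, the vertices $j$ for which there is a vertex $i$ activated at time $t-1$ lying to the left of $j$ within distance $R_j$ (that is, $j-R_j\le i<j$) are activated. The process is called heterogeneous when the $R_i$ are not required to be identically distributed. The process survives (event $S$) if infinitely many vertices are activated in the course of time. *)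

(* Defs.v *)
From HB Require Import structures.
From mathcomp Require Export all_boot all_order all_algebra finmap.
From mathcomp Require Export all_classical all_reals all_analysis.
Import Order.TTheory GRing.Theory Num.Theory.
Import numFieldNormedType.Exports.

Set Implicit Arguments.
Unset Strict Implicit.
Unset Printing Implicit Defensive.

Local Open Scope classical_set_scope.
Local Open Scope ereal_scope.

Definition mutually_independent (d d' : measure_display) (T : measurableType d)
    (T' : measurableType d') (K : realType) (P : probability T K)
    (I : choiceType) (X : I -> {RV P >-> T'}) : Prop :=
  forall (J : {fset I}) (A : I -> set T'), (forall i, measurable (A i)) ->
    P (\bigcap_(i in [set` J]) (X i @^-1` A i)) =
    \prod_(i <- J) P (X i @^-1` A i).

Arguments mutually_independent {d d' T T' K} P {I} X.

(* \prod_(k = 1)^oo f k; the limit exists whenever all f k are in [0, 1]. *)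
Definition eprod1 (K : realType) (f : nat -> \bar K) : \bar K :=
  limn (fun m => \prod_(1 <= k < m.+1) f k).

(* In the successor case i < j, so j - i is the actual distance. *)
Fixpoint activated_at (r : nat -> nat) (t j : nat) : Prop :=
  match t with
  | 0%N => j = 0%N
  | t'.+1 => exists i, [/\ activated_at r t' i, (i < j)%N & (j - i <= r j)%N]
  end.

Definition activated (r : nat -> nat) : set nat :=
  [set j | exists t, activated_at r t j].

Definition survival (T : Type) (R : nat -> T -> nat) : set T :=
  [set w | infinite_set (activated (fun i => R i w))].

Lemma measurable_survival (d : measure_display) (T : measurableType d)
    (K : realType) (P : probability T K) (R : nat -> {RV P >-> nat}) :
  measurable (survival R).
Proof.
have mR (j : nat) (B : set nat) : measurable (R j @^-1` B).
  by rewrite -[X in measurable X]setTI; exact: measurable_funP.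
have mact t j : measurable [set w | activated_at (fun i => R i w) t j].
  elim: t j => [|t IH] j /=.
    have [->|/eqP j0] := eqVneq j 0%N.
      rewrite (_ : [set _ | _] = setT); first exact: measurableT.
      by apply/seteqP; split.
    rewrite (_ : [set _ | _] = set0); first exact: measurable0.
    by apply/seteqP; split.
  rewrite (_ : [set _ | _] = \bigcup_(i in [set i | (i < j)%N])
      ([set w | activated_at (fun i => R i w) t i] `&`
       R j @^-1` [set n | (j - i <= n)%N])); last first.
    apply/seteqP; split=> w /=.
      by case=> i [ai ij ri]; exists i.
    by case=> i /= ij [ai ri]; exists i.
  by apply: bigcup_measurable => i _; apply: measurableI.
rewrite (_ : survival R = \bigcap_N \bigcup_(j in [set j | (N <= j)%N]) \bigcup_t
    [set w | activated_at (fun i => R i w) t j]).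
  apply: bigcap_measurableType => N _; apply: bigcup_measurable => j _.
  by apply: bigcup_measurable => t _.
apply/seteqP; split=> w /=.
  move=> inf N _; apply: contrapT => nex; apply: inf.
  apply: (sub_finite_set (B := `I_N)); last exact: finite_II.
  move=> j [t aj] /=; rewrite ltnNge; apply/negP => Nj; apply: nex.
  by exists j => //; exists t.
move=> H fin.
have [N NP] : exists N, forall j, activated (fun i => R i w) j -> (j < N)%N.
  have /finite_fsetP[X XE] := fin.
  exists (\max_(x <- X) x).+1 => j; rewrite XE /= => jX.
  by rewrite ltnS; exact: (@leq_bigmax_seq _ _ _ id).
have [j /= Nj [t _ aj]] := H N I.
have := NP j (ex_intro _ t aj).
by rewrite ltnNge Nj.
Qed.

(* Main.v *)
Require Import Defs.
From mathcomp Require Import zify lra.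
Import Order.TTheory GRing.Theory Num.Theory.
Import numFieldNormedType.Exports.

(** Let A_n be the event that no vertex to the right of n reaches back to n,
    that is, R_{n+k} < k for every k >= 1. If A_n occurs, nothing beyond n is
    ever activated, since the first vertex to be activated there would need a
    radius reaching n; conversely, the largest vertex activated in a dying
    process is such an n. So extinction is the union of the A_n
    ([extinction_unreached]), and by independence and continuity from above
    P(A_n) is the infinite product of the P(R_{n+k} < k)
    ([probability_unreached]).

    Part (I). P(S) = 1 means that every A_n is null. A product of factors
    1 - p_k is at most exp(- sum p_k), so divergence of the series kills A_n
    ([unreached_eq0]); if the series for n converges, A_n has positive
    probability ([unreached_gt0]).

    Part (II). Survival means that every A_n fails ([survival_gt0]).

    Both positivity claims are one argument, [avoid_summable_events]: if the
    E_k have summable probabilities, the union of those with k >= N has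
    probability less than 1 for N large, and intersecting with an event B_N of
    positive probability, independent of each of those E_k, leaves positive
    probability to B_N minus the union. For (I), E_k says that the vertex
    n + k + 1 reaches n, and B_N that the vertices n + 1, ..., n + N do not.
    For (II), E_k is A_{k+1}, and B_N says that R_1, ..., R_{N+1} are all at
    least 1, which rules out A_0, ..., A_N; for k >= N, the event A_{k+1}
    involves only radii of vertices beyond N + 1 ([indep_unreached]), so it is
    independent of B_N. *)

Set Implicit Arguments.
Unset Strict Implicit.
Unset Printing Implicit Defensive.

Local Open Scope classical_set_scope.
Local Open Scope ereal_scope.

(** * Extinction *)

Definition unreached (T : Type) (R : nat -> T -> nat) (n : nat) : set T :=
  [set w | forall k, (0 < k)%N -> (R (n + k)%N w < k)%N].

(** If the activated vertices are finite in number, the largest one is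
    unreached, because a vertex reaching it would be activated next. If n is
    unreached, induction on time keeps the activated vertices at or below n: a
    vertex beyond n with an activator at or below n would reach n. *)
Lemma extinction_unreached (T : Type) (R : nat -> T -> nat) :
  ~` survival R = \bigcup_n unreached R n.
Proof.
apply/seteqP; split => w /=.
  rewrite /survival/= => /contrapT fin.
  have a0 : activated (fun i => R i w) 0%N by exists 0%N.
  have [n an nmax] : exists2 n, activated (fun i => R i w) n &
      forall j, activated (fun i => R i w) j -> (j <= n)%N.
    have /finite_fsetP[X XE] := fin.
    have X0 : 0%N \in X by move: a0; rewrite XE.
    have nmax j : j \in X -> (j <= \max_(x <- X) x)%N.
      by move=> jX; exact: (@leq_bigmax_seq _ _ _ id).
    have [n nX nn] := ex_maxnP (ex_intro (fun j => j \in X) _ X0) nmax.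
    by exists n => [|j]; rewrite XE//; exact: nn.
  exists n => // k k0 /=; rewrite ltnNge; apply/negP => kR.
  have [t at_] := an.
  have : activated (fun i => R i w) (n + k)%N.
    by exists t.+1, n; split=> //; lia.
  by move=> /nmax; lia.
case=> n _ nreach; apply.
apply: (sub_finite_set (B := `I_n.+1)); last exact: finite_II.
move=> j [t]; elim: t j => [|t IH] j /=; first by move=> ->.
case=> i [/IH + ij rj]; rewrite !ltnS => /= inn.
rewrite leqNgt; apply/negP => nj.
by have := nreach (j - n)%N; rewrite subnKC; lia.
Qed.

(** * Avoiding a summable family of events *)

Section probability_lemmas.
Context (d : measure_display) (T : measurableType d) (K : realType).
Variable P : probability T K.

(** Subadditivity and the product rule bound the part of B N lost to the E k
    with k >= N by P (B N) * \sum_(k >= N) P (E k), and N is chosen to make the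
    sum less than 1. *)
Lemma avoid_summable_events (E B : nat -> set T) :
  (forall k, measurable (E k)) -> (forall N, measurable (B N)) ->
  (forall N, 0 < P (B N)) ->
  (forall N k, (N <= k)%N -> P (B N `&` E k) = P (B N) * P (E k)) ->
  \sum_(0 <= k <oo) P (E k) < +oo ->
  exists N, 0 < P (B N `\` \bigcup_(k in ~` `I_N) E k).
Proof.
move=> mE mB B0 BE sumE.
have tail0 := nneseries_tail_cvg sumE (fun k _ => measure_ge0 P (E k)).
have [N _ /(_ N (leqnn N)) tailN] :
    \forall N \near \oo, \sum_(N <= k <oo) P (E k) < 1.
  exact: (tail0 _ (open_ereal_lt' lte01)).
exists N.
have mU : measurable (\bigcup_(k in ~` `I_N) E k) by exact: bigcup_measurable.
rewrite measureD//; last by rewrite ltey_eq fin_num_measure.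
rewrite sube_gt0 setI_bigcupr.
apply: (@le_lt_trans _ _ (\sum_(N <= k <oo) P (B N `&` E k))).
  by apply: measure_sigma_subadditive_tail => [k| |//];
    [|apply: bigcup_measurable => k _]; apply: measurableI.
have -> : \sum_(N <= k <oo) P (B N `&` E k) =
    P (B N) * \sum_(N <= k <oo) P (E k).
  rewrite -(fineK (fin_num_measure P _ (mB N))) -nneseriesZl//.
  rewrite eseries_cond [RHS]eseries_cond; apply: eq_eseriesr => k /= Nk.
  by rewrite fineK ?fin_num_measure// BE.
by rewrite -[ltRHS]mule1 lte_pmul2l ?fin_num_measure.
Qed.

End probability_lemmas.

(** * Finitely many radii *)

Section independence.
Context (d : measure_display) (T : measurableType d) (K : realType).
Variables (P : probability T K) (R : nat -> {RV P >-> nat}).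
Hypothesis indepR : mutually_independent P R.

Definition cylinder (A : nat -> set nat) (s : seq nat) : set T :=
  \bigcap_(i in [set` s]) (R i @^-1` A i).

Lemma measurable_preimage_nat i (B : set nat) : measurable (R i @^-1` B).
Proof. by rewrite -[X in measurable X]setTI; exact: measurable_funP. Qed.

Lemma measurable_le_radius k i : measurable [set w | (k <= R i w)%N].
Proof. exact: (measurable_preimage_nat i [set r | (k <= r)%N]). Qed.

Lemma setC_le_radius k i :
  ~` [set w | (k <= R i w)%N] = [set w | (R i w < k)%N].
Proof. by apply/seteqP; split => w /=; lia. Qed.

Lemma measurable_gt_radius k i : measurable [set w | (R i w < k)%N].
Proof. exact: (measurable_preimage_nat i [set r | (r < k)%N]). Qed.

Lemma measurable_cylinder A s : measurable (cylinder A s).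
Proof.
by apply: bigcap_measurableType => i _; exact: measurable_preimage_nat.
Qed.

Lemma probability_cylinder A s : uniq s ->
  P (cylinder A s) = \prod_(i <- s) P (R i @^-1` A i).
Proof.
move=> us; have E : perm_eq (seq_fset tt s) s.
  by rewrite -{2}(undup_id us); exact: seq_fset_perm.
rewrite -(perm_big _ E) -indepR//.
by congr (P _); apply: eq_bigcapl; split => i /=; rewrite (perm_mem E).
Qed.

(** The two constraints act on disjoint sets of indices, so they merge into a
    single family of constraints on s1 ++ s2. *)
Lemma indep_cylinder A1 A2 s1 s2 : uniq (s1 ++ s2) ->
  P (cylinder A1 s1 `&` cylinder A2 s2) =
  P (cylinder A1 s1) * P (cylinder A2 s2).
Proof.
move=> us; have := us; rewrite cat_uniq => /and3P[us1 /hasPn s12 us2].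
pose A i := if i \in s1 then A1 i else A2 i.
have -> : cylinder A1 s1 = cylinder A s1.
  by apply: eq_bigcapr => i /= is1; rewrite /A is1.
have -> : cylinder A2 s2 = cylinder A s2.
  by apply: eq_bigcapr => i /= is2; rewrite /A (negbTE (s12 _ is2)).
have -> : cylinder A s1 `&` cylinder A s2 = cylinder A (s1 ++ s2).
  rewrite /cylinder -bigcap_setU.
  apply: eq_bigcapl; split => i /=; rewrite mem_cat.
    by case=> ->; rewrite ?orbT.
  by move/orP.
by rewrite !probability_cylinder// big_cat.
Qed.

(** * The probability that a vertex is unreached *)

Definition unreached_upto n m : set T :=
  [set w | forall k, (0 < k <= m)%N -> (R (n + k)%N w < k)%N].

Lemma unreached_upto_cylinder n m :
  unreached_upto n m =
  cylinder (fun i => [set r | (r < i - n)%N]) (iota n.+1 m).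
Proof.
apply/seteqP; split => w /= H.
  move=> i /=; rewrite mem_iota => /andP[ni im].
  by have := H (i - n)%N; rewrite subnKC ?(ltnW ni)//; apply; lia.
move=> k km; have := H (n + k)%N; rewrite /= mem_iota addKn; apply; lia.
Qed.

Lemma measurable_unreached_upto n m : measurable (unreached_upto n m).
Proof. by rewrite unreached_upto_cylinder; exact: measurable_cylinder. Qed.

Lemma unreachedE n : unreached R n = \bigcap_m unreached_upto n m.
Proof.
apply/seteqP; split => w /= H; first by move=> m _ k /andP[k0 _]; exact: H.
by move=> k k0; apply: (H k I); rewrite k0 leqnn.
Qed.

Lemma measurable_unreached n : measurable (unreached R n).
Proof.
rewrite unreachedE; apply: bigcap_measurableType => m _.
exact: measurable_unreached_upto.
Qed.

(** The extra event B lets the same limit serve to compute P (unreached R n),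
    with B = setT, and to prove its independence from earlier radii. *)
Lemma unreached_upto_cvg (B : set T) n : measurable B ->
  P (B `&` unreached_upto n m) @[m --> \oo] --> P (B `&` unreached R n).
Proof.
move=> mB; rewrite unreachedE -bigcapIr; last by exists 0%N.
have mBu m : measurable (B `&` unreached_upto n m).
  by apply: measurableI => //; exact: measurable_unreached_upto.
apply: nonincreasing_cvg_mu => //.
- by rewrite ltey_eq fin_num_measure.
- exact: bigcap_measurableType.
- move=> m p mp; apply/subsetPset; apply: setIS => w H k /andP[k0 km].
  by apply: H; rewrite k0 (leq_trans km).
Qed.

(** [unreached R n] constrains only the radii of the vertices beyond n; the
    product rule holds for each of its finite truncations and passes to the
    limit. *)
Lemma indep_unreached A s n : uniq s -> {in s, forall i, i <= n}%N ->
  P (cylinder A s `&` unreached R n) = P (cylinder A s) * P (unreached R n).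
Proof.
move=> us sn; have mA := measurable_cylinder A s.
have c1 := @unreached_upto_cvg _ n mA.
have c2 : P (cylinder A s `&` unreached_upto n m) @[m --> \oo] -->
    P (cylinder A s) * P (unreached R n).
  have indep m : P (cylinder A s `&` unreached_upto n m) =
      P (cylinder A s) * P (unreached_upto n m).
    rewrite unreached_upto_cylinder indep_cylinder// cat_uniq us iota_uniq andbT.
    apply/hasPn => i; rewrite mem_iota => /andP[ni _].
    by apply/negP => /sn; lia.
  under eq_fun do rewrite indep.
  apply: cvgeZl; first by rewrite fin_num_measure.
  have := @unreached_upto_cvg _ n measurableT.
  by rewrite setTI; under eq_fun do rewrite setTI.
exact: (cvg_unique _ c1 c2).
Qed.

Lemma probability_unreached_upto n m :
  P (unreached_upto n m) =
  \prod_(1 <= k < m.+1) P [set w | (R (n + k)%N w < k)%N].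
Proof.
rewrite unreached_upto_cylinder probability_cylinder ?iota_uniq//.
rewrite /index_iota subn1/= -(addn1 n) iotaDl big_map.
by apply: eq_bigr => k _; rewrite addKn.
Qed.

Lemma probability_unreached n :
  P (unreached R n) = eprod1 (fun k => P [set w | (R (n + k)%N w < k)%N]).
Proof.
apply/esym/cvg_lim => //.
have := @unreached_upto_cvg _ n measurableT; rewrite setTI.
by under eq_fun do rewrite setTI probability_unreached_upto.
Qed.

(** * Null and positive probabilities *)

Lemma cylinder_gt0 A s :
  uniq s -> (forall i, i \in s -> 0 < P (R i @^-1` A i)) ->
  0 < P (cylinder A s).
Proof.
move=> us A0; rewrite probability_cylinder// big_seq.
by apply: (big_ind (fun x => 0 < x)) => // x y; exact: mule_gt0.
Qed.

(** With p k the probability that n + k reaches n, 1 - p k <= exp (- p k), so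
    the truncated products are at most exp (- \sum_(k <= m) p k). *)
Lemma unreached_eq0 n :
  \sum_(1 <= k <oo) P [set w | (k <= R (n + k)%N w)%N] = +oo ->
  P (unreached R n) = 0.
Proof.
move=> sumy; pose p k := fine (P [set w | (k <= R (n + k)%N w)%N]).
have pE k : P [set w | (k <= R (n + k)%N w)%N] = (p k)%:E.
  by rewrite fineK// fin_num_measure//; exact: measurable_le_radius.
have le_exp m :
    P (unreached_upto n m) <= (expR (- \sum_(1 <= k < m.+1) p k))%:E.
  rewrite probability_unreached_upto.
  elim: m => [|m IH]; first by rewrite !big_nil oppr0 expR0.
  rewrite !(big_nat_recr m.+1)//= opprD expRD EFinM.
  apply: lee_pmul => //; first by apply: prode_ge0.
  rewrite -setC_le_radius probability_setC; last exact: measurable_le_radius.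
  by rewrite pE -EFinB lee_fin expR_ge1Dx.
have le_unreached m : P (unreached R n) <= P (unreached_upto n m).
  apply: (le_measure P); rewrite ?inE;
    [exact: measurable_unreached|exact: measurable_unreached_upto|].
  by move=> w H k /andP[k0 _]; exact: H.
apply/eqP; rewrite eq_le measure_ge0 andbT leNgt; apply/negP => P0.
have fP : P (unreached R n) \is a fin_num.
  by rewrite fin_num_measure//; exact: measurable_unreached.
pose q := fine (P (unreached R n)).
have q0 : (0 < q)%R by rewrite fine_gt0// P0 ltey_eq fP.
(* 1 - ln q makes the bound at most q / e, which is less than q; the rank
   m.+1 matches the upper end of the sum in le_exp. *)
have [m _ /(_ m.+1 (leqnSn m))] : \forall m \near \oo, (1 - ln q)%:E <=
    \sum_(1 <= k < m) P [set w | (k <= R (n + k)%N w)%N].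
  apply: lte_lim; last by rewrite sumy ltry.
  - by apply: ereal_nondecreasing_series => k _ _.
  - by apply: is_cvg_nneseries.
under eq_bigr do rewrite pE.
rewrite sumEFin lee_fin => lem.
have := le_trans (le_unreached m) (le_exp m).
rewrite -(fineK fP) lee_fin -/q -{1}(lnK q0) ler_expR; lra.
Qed.

(** The finitely many vertices n + 1, ..., n + N fail to reach n with positive
    probability, because all their radii may vanish; those beyond form a
    summable family independent of them. *)
Lemma unreached_gt0 n : (forall i, 0 < P [set w | (R i w < 1)%N]) ->
  \sum_(1 <= k <oo) P [set w | (k <= R (n + k)%N w)%N] < +oo ->
  0 < P (unreached R n).
Proof.
move=> R0 sumfin.
pose E k := R (n + k.+1)%N @^-1` [set r | (k.+1 <= r)%N].
have [|||||N] := @avoid_summable_events _ _ _ P E (unreached_upto n).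
- by move=> k; exact: measurable_preimage_nat.
- by move=> N; exact: measurable_unreached_upto.
- move=> N; rewrite unreached_upto_cylinder.
  apply: cylinder_gt0; first exact: iota_uniq.
  move=> i; rewrite mem_iota => /andP[ni _].
  apply: lt_le_trans (R0 i) _.
  apply: (le_measure P); rewrite ?inE;
    [exact: measurable_gt_radius|exact: measurable_preimage_nat|].
  by move=> w /=; lia.
- move=> N k Nk; rewrite unreached_upto_cylinder.
  have -> : E k = cylinder (fun=> [set r | (k.+1 <= r)%N]) [:: (n + k.+1)%N].
    apply/seteqP; split => w /=; last by apply; rewrite /= mem_head.
    by move=> wE i /=; rewrite inE => /eqP ->.
  apply: indep_cylinder; rewrite cats1 rcons_uniq iota_uniq andbT mem_iota; lia.
- apply: le_lt_trans sumfin; rewrite -[leRHS]nneseries_addn//.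
  by under [leRHS]eq_eseriesr do rewrite addn1.
move=> /lt_le_trans; apply; apply: (le_measure P); rewrite ?inE.
- apply: measurableD; first exact: measurable_unreached_upto.
  by apply: bigcup_measurable => k _; exact: measurable_preimage_nat.
- exact: measurable_unreached.
move=> w [wB wE] [//|k] _; have [kN|Nk] := ltnP k N; first by apply: wB; lia.
by rewrite ltnNge; apply/negP => kR; apply: wE; exists k => //=; lia.
Qed.

(** If R_1, ..., R_{N+1} are at least 1, each vertex up to N is reached by
    its successor, so the process dies only if some n > N is unreached. *)
Lemma survival_gt0 : (forall i, P [set w | (R i w < 1)%N] < 1) ->
  \sum_(1 <= n <oo) P (unreached R n) < +oo ->
  0 < P (survival R).
Proof.
move=> R1 sumfin.
pose B N := cylinder (fun=> [set r | (1 <= r)%N]) (iota 1 N.+1).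
have [|||||N] := @avoid_summable_events _ _ _ P (fun k => unreached R k.+1) B.
- by move=> k; exact: measurable_unreached.
- by move=> N; exact: measurable_cylinder.
- move=> N; apply: cylinder_gt0; first exact: iota_uniq.
  move=> i _; rewrite -[_ @^-1` _]setCK (setC_le_radius 1 i).
  rewrite probability_setC; last exact: measurable_gt_radius.
  by rewrite sube_gt0.
- move=> N k Nk; apply: indep_unreached; first exact: iota_uniq.
  by move=> i; rewrite mem_iota; lia.
- apply: le_lt_trans sumfin; rewrite -[leRHS]nneseries_addn//.
  by under [leRHS]eq_eseriesr do rewrite addn1.
move=> /lt_le_trans; apply; apply: (le_measure P); rewrite ?inE.
- apply: measurableD; first exact: measurable_cylinder.
  by apply: bigcup_measurable => k _; exact: measurable_unreached.
- exact: measurable_survival.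
move=> w [wB wE]; apply: contrapT => dead.
have : (~` survival R) w := dead; rewrite extinction_unreached => -[n _ wn].
have [nN|Nn] := leqP n N.
  have /wB : n.+1 \in iota 1 N.+1 by rewrite mem_iota; lia.
  by have := wn 1%N isT; rewrite /= addn1; lia.
by apply: wE; case: n Nn wn => // n Nn wn; exists n => //=; lia.
Qed.

End independence.

Theorem theorem2p10 (d : measure_display) (T : measurableType d) (K : realType)
    (P : probability T K) (R : nat -> {RV P >-> nat})
    (indepR : mutually_independent P R)
    (R_lt1 : forall i, 0 < P [set w | (R i w < 1)%N] < 1) :
  ((forall n, \sum_(1 <= k <oo) P [set w | (k <= R (n + k)%N w)%N] = +oo)
     <-> P (survival R) = 1)
  /\
  (\sum_(1 <= n <oo) eprod1 (fun k => P [set w | (R (n + k)%N w < k)%N]) < +oo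
     -> 0 < P (survival R)).
Proof.
have survivalC : P (~` survival R) = 1 - P (survival R).
  by rewrite probability_setC//; exact: measurable_survival.
have mS n := measurable_unreached R n.
split; first split.
- move=> sumy; have : P (~` survival R) = 0.
    apply/negligibleP; first exact: (measurableC (measurable_survival R)).
    rewrite extinction_unreached; apply: negligible_bigcup => n.
    by apply/negligibleP; [exact: mS|exact: unreached_eq0].
  rewrite survivalC => /eqP; rewrite sube_eq ?fin_num_measure// => /eqP ->.
  by rewrite add0e.
- move=> PS1 n; apply/eqP; rewrite -leye_eq leNgt; apply/negP => sumfin.
  have R0 i : 0 < P [set w | (R i w < 1)%N] by have /andP[] := R_lt1 i.
  have := unreached_gt0 indepR R0 sumfin; apply/negP; rewrite -leNgt.
  rewrite -(subee (_ : 1 \is a fin_num))// -{2}PS1 -survivalC.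
  rewrite extinction_unreached.
  apply: (le_measure P); rewrite ?inE; [exact: mS| |].
    by apply: bigcup_measurable => k _; exact: mS.
  by move=> w wn; exists n.
- move=> sumfin; apply: (survival_gt0 indepR) => [i|].
    by have /andP[] := R_lt1 i.
  by under eq_eseriesr do rewrite probability_unreached//.
Qed.
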